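(* A pair $(q^*_{g^*},g^* )$ is optimal for the quantile-form insurer's problem $$\max_g V^{In}(q_g,g)\quad\text{subject to}\quad q_g\in\arg\min_{q\in\mathcal Q_L}\rho^{Pol}(q,g)$$ if and only if: (1) $g^*(t)=1-\tilde g^*(1-t)$ for all $t\in[0,1]$, where $$\tilde g^*(t)\begin{cases}=\tilde T(t), & \tilde T(t)<t,\\ \in\big[\sup\{\tilde g^*(z):z<t\},\ \tilde T(t)\big], & \tilde T(t)\ge t;\end{cases}$$ (2) for almost every $t$, $$(q^*_{g^*})'(t)=\begin{cases}0, & \tilde T(t)<t,\\ \phi_{g^*}(t), & t\in\{z:\tilde g^*(z)=\tilde T(z)=z\},\\ (F_X^{-1})'(t), & t\in\{z:\tilde g^*(z)<\tilde T(z)=z\}\cup\{z:\tilde T(z)>z\},\end{cases}$$ where $\phi_{g^*}(t)\in[0,(F_X^{-1})'(t)]$ for a.e. $t$ with $\tilde g^*(t)=\tilde T(t)=t$. Moreover, the insurer's expected profit is $$V^{In}(q^*_{g^*},g^* )=\int_0^1(F_X^{-1})'(t)\,(t-\tilde T(t))\,\mathbf 1_{\{\tilde T(t)<t\}}\,\mathrm dt.$$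
   Context: $(\Omega,\mathcal F,\mathbb P)$ is a non-atomic probability space; $X\ge 0$ is bounded with range $[0,M]$ and strictly increasing distribution function $F_X$, left-continuous quantile $F_X^{-1}$. A distortion function is a non-decreasing differentiable map $h:[0,1]\to[0,1]$ with $h(0)=0$, $h(1)=1$; its conjugate is $\tilde h(t)=1-h(1-t)$. The policyholder has distortion function $T$ (conjugate $\tilde T$); $g$ denotes the insurer's pricing distortion. $\mathcal Q_L=\{q:(0,1)\to\mathbb R_+ \text{ non-decreasing, left-continuous}: q(0)=0,\ 0\le q'(t)\le (F_X^{-1})'(t)\text{ a.e.}\}$; $\rho^{Pol}(q,g)=\int_0^1 q'(t)[T(1-t)-g(1-t)]\mathrm dt+\int_0^1(F_X^{-1})'(t)g(1-t)\mathrm dt$; $V^{In}(q,g)=\int_0^1[(F_X^{-1})'(t)-q'(t)]g(1-t)\,\mathrm dt-\int_0^1[F_X^{-1}(t)-q(t)]\,\mathrm dt$. The insurer jointly chooses $g$ and a policyholder-optimal $q_g$.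
   Formalization: The quantile of X is assumed strictly increasing (X has no atoms; otherwise ''only if'' fails) and absolutely continuous, and each q in Q_L is taken to be the integral of q' (with jumps in q the insurer's profit would be unbounded). *)

(* Defs.v *)
From HB Require Import structures.
From mathcomp Require Import all_boot all_order all_algebra.
From mathcomp Require Import all_classical all_reals all_analysis.
Set Implicit Arguments. Unset Strict Implicit. Unset Printing Implicit Defensive.
Import Order.TTheory GRing.Theory Num.Theory.
Import numFieldNormedType.Exports.
Local Open Scope classical_set_scope.
Local Open Scope ring_scope.

Section Defs.
Variable R : realType.
Local Notation mu := (@lebesgue_measure R).

Definition diff01 (h : R -> R) : Prop :=
  {in `]0, 1[, forall x, derivable h x 1} /\
  (exists l : R, (fun e => e^-1 * (h e - h 0)) @ 0^'+ --> l) /\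
  (exists l : R, (fun e => e^-1 * (h 1 - h (1 - e))) @ 0^'+ --> l).

(* distortion function: non-decreasing differentiable h : [0,1] -> [0,1],
   h 0 = 0, h 1 = 1 (only its values on [0,1] matter). *)
Definition distortion (h : R -> R) : Prop :=
  diff01 h /\
  {in `[0, 1] &, {homo h : x y / x <= y}} /\
  (forall t, 0 <= t <= 1 -> 0 <= h t <= 1) /\
  h 0 = 0 /\ h 1 = 1.

Definition conj_dist (h : R -> R) (t : R) : R := 1 - h (1 - t).

(* q reconstructed from its derivative qd: q(t) = int_0^t qd *)
Definition qfun (qd : R -> R) (t : R) : R := \int[mu]_(s in `[0, t]) qd s.

(* Q_L, described through the derivative qd = q' of q:
   q(t) = int_0^t q', q' measurable and 0 <= q' <= (F_X^{-1})' a.e. on (0,1).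
   Here fd = (F_X^{-1})'. *)
Definition QL (fd qd : R -> R) : Prop :=
  measurable_fun (`[0, 1] : set R) qd /\
  {ae mu, forall t, t \in `]0, 1[ -> 0 <= qd t <= fd t}.

Definition rhoPol (T fd qd g : R -> R) : R :=
  \int[mu]_(t in `[0, 1]) (qd t * (T (1 - t) - g (1 - t)))
  + \int[mu]_(t in `[0, 1]) (fd t * g (1 - t)).

(* insurer's objective V^In(q,g); Finv = F_X^{-1}, fd = (F_X^{-1})' *)
Definition VIn (Finv fd qd g : R -> R) : R :=
  \int[mu]_(t in `[0, 1]) ((fd t - qd t) * g (1 - t))
  - \int[mu]_(t in `[0, 1]) (Finv t - qfun qd t).

Definition ph_optimal (T fd qd g : R -> R) : Prop :=
  QL fd qd /\ forall qd', QL fd qd' -> rhoPol T fd qd g <= rhoPol T fd qd' g.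

(* (q, g) is optimal for the insurer's problem:
   max_g V^In(q_g, g) s.t. q_g in argmin_{q in Q_L} rho^Pol(q, g),
   the insurer choosing jointly g and a policyholder-optimal q_g. *)
Definition insurer_optimal (T Finv fd qd g : R -> R) : Prop :=
  distortion g /\ ph_optimal T fd qd g /\
  forall g' qd', distortion g' -> ph_optimal T fd qd' g' ->
    VIn Finv fd qd' g' <= VIn Finv fd qd g.

End Defs.

(* Main.v *)
(* Write G and S for the conjugates of g and T. Tonelli on the triangle
   s <= t turns the insurer's profit into the integral of (fd - q') (t - G),
   and the policyholder's objective is, up to a constant, the integral of
   q' (G - S). Minimising the latter pointwise, a policyholder-optimal q'
   equals fd where G < S and 0 where S < G, so the profit density is at most
   fd (t - S)^+. The choice g = T attains this bound, hence optimality means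
   almost everywhere equality of the densities. The a.e. identities become the
   pointwise conditions on G because G and S are continuous and fd is not
   a.e. zero on any interval. *)
Require Import Defs.
From HB Require Import structures.
From mathcomp Require Import all_boot all_order all_algebra.
From mathcomp Require Import all_classical all_reals all_analysis.
From mathcomp Require Import measurable_realfun ring lra.
Import Order.TTheory GRing.Theory Num.Theory.
Import numFieldNormedType.Exports.
Local Open Scope classical_set_scope.
Local Open Scope ring_scope.

(** * Real integrals under almost everywhere comparison *)

Section ae_Rintegral.
Context {d : measure_display} {T : measurableType d} {R : realType}.
Variables (mu : {measure set T -> \bar R}) (D : set T).
Hypothesis mD : measurable D.
Implicit Types f g : T -> R.

Lemma ae_eq_Rintegral f g : measurable_fun D f -> measurable_fun D g ->
  {ae mu, forall x, D x -> f x = g x} ->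
  \int[mu]_(x in D) f x = \int[mu]_(x in D) g x.
Proof.
move=> mf mg fg; congr fine; apply: ae_eq_integral => //.
- exact/measurable_EFinP.
- exact/measurable_EFinP.
- by apply: filterS fg => x fg Dx; rewrite fg.
Qed.

Lemma ae_le_integrable f g : measurable_fun D f ->
  {ae mu, forall x, D x -> `|f x| <= g x} ->
  mu.-integrable D (EFin \o g) -> mu.-integrable D (EFin \o f).
Proof.
move=> mf fg /integrableP[/measurable_EFinP mg goo]; apply/integrableP; split.
  exact/measurable_EFinP.
apply: le_lt_trans goo; apply: ae_ge0_le_integral => //.
- by do 2 apply: measurableT_comp => //.
- by do 2 apply: measurableT_comp => //.
- apply: filterS fg => x fg Dx; rewrite /= lee_fin.
  by rewrite (le_trans (fg Dx))// ler_norm.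
Qed.

(** Source of both the monotonicity of the integral and its equality case: the gap between the two
    integrals is an L1 norm. *)
Lemma ae_subr_ge0_Rintegral f g :
  mu.-integrable D (EFin \o f) -> mu.-integrable D (EFin \o g) ->
  {ae mu, forall x, D x -> f x <= g x} ->
  \int[mu]_(x in D) g x - \int[mu]_(x in D) f x =
  \int[mu]_(x in D) `|g x - f x|.
Proof.
move=> intf intg fg; rewrite -RintegralB//.
have mf : measurable_fun D f by exact/measurable_EFinP/(measurable_int mu).
have mg : measurable_fun D g by exact/measurable_EFinP/(measurable_int mu).
apply: ae_eq_Rintegral.
- exact: measurable_funB.
- by apply: measurableT_comp => //; exact: measurable_funB.
- by apply: filterS fg => x fg Dx; rewrite ger0_norm// subr_ge0 fg.
Qed.

Lemma ae_le_Rintegral f g :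
  mu.-integrable D (EFin \o f) -> mu.-integrable D (EFin \o g) ->
  {ae mu, forall x, D x -> f x <= g x} ->
  \int[mu]_(x in D) f x <= \int[mu]_(x in D) g x.
Proof.
move=> intf intg fg; rewrite -subr_ge0 ae_subr_ge0_Rintegral//.
exact: Rintegral_ge0.
Qed.

(** The gap is an L1 norm that is at most 0, so [g - f] vanishes a.e. Optimality of an integral
    becomes equality of densities in this way. *)
Lemma ae_eq_le_Rintegral f g :
  mu.-integrable D (EFin \o f) -> mu.-integrable D (EFin \o g) ->
  {ae mu, forall x, D x -> f x <= g x} ->
  \int[mu]_(x in D) g x <= \int[mu]_(x in D) f x ->
  {ae mu, forall x, D x -> f x = g x}.
Proof.
move=> intf intg fg; rewrite -subr_le0 ae_subr_ge0_Rintegral// => le0.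
have mf : measurable_fun D f by exact/measurable_EFinP/(measurable_int mu).
have mg : measurable_fun D g by exact/measurable_EFinP/(measurable_int mu).
have intgf : mu.-integrable D (EFin \o (g \- f)).
  by have := integrableB mD intg intf; apply: eq_integrable.
(* Since [fine] also sends infinity to 0, finiteness has to be known before the extended integral
   can be declared null. *)
have gf0 : (\int[mu]_(x in D) `|(EFin \o (g \- f)%R) x| = 0)%E.
  rewrite -[LHS]fineK; last first.
    exact/integrable_fin_num/integrable_abse.
  congr EFin; apply/le_anti; rewrite [X in X && _]le0/=.
  exact: Rintegral_ge0.
have /(ae_eq_integral_abs mu mD) : measurable_fun D (EFin \o (g \- f)).
  exact/measurable_EFinP/measurable_funB.
move=> [/(_ gf0) + _]; apply: filterS => x gf Dx.
by apply/esym/eqP; rewrite -subr_eq0; have [->] := gf Dx.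
Qed.

Lemma integrable_mulr_bounded f g (M : R) : measurable_fun D g ->
  (forall x, D x -> `|g x| <= M) -> mu.-integrable D (EFin \o f) ->
  mu.-integrable D (EFin \o (fun x => f x * g x)).
Proof.
move=> mg gM intf.
have mf : measurable_fun D f by exact/measurable_EFinP/(measurable_int mu).
apply: (@ae_le_integrable _ (fun x => M * `|f x|)).
- exact: measurable_funM.
- apply: aeW => x Dx; rewrite normrM mulrC ler_wpM2r// gM//.
- have := integrableZl mD M (integrable_norm intf); exact: eq_integrable.
Qed.

Lemma measurable_fun_if_lt (u v f g : T -> R) :
  measurable_fun D u -> measurable_fun D v ->
  measurable_fun D f -> measurable_fun D g ->
  measurable_fun D (fun x => if u x < v x then f x else g x).
Proof.
move=> mu_ mv mf mg; apply: measurable_fun_if => //.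
- exact: measurable_fun_ltr.
- by apply: (measurable_funS mD) mf; exact: subIsetl.
- by apply: (measurable_funS mD) mg; exact: subIsetl.
Qed.

End ae_Rintegral.

#[local] Instance lebesgue_ae_filter (R : realType) :
  Filter (almost_everywhere (@lebesgue_measure R)).
Proof. exact: ae_filter_ringOfSetsType. Qed.

(** * Lebesgue measure on the unit interval and Tonelli on a triangle *)

Section unit_interval.
Context {R : realType}.
Local Notation mu := (@lebesgue_measure R).
Local Notation I01 := (`[0, 1]%classic : set R).

(** The endpoints are null; this links the open interval of [QL] with the closed one of the
    integrals. *)
Lemma ae_itv01 (P : R -> Prop) :
  {ae mu, forall t, t \in `]0, 1[ -> P t} <-> {ae mu, forall t, I01 t -> P t}.
Proof.
split=> [h|]; last first.
  by apply: filterS => t Pt t01; apply: Pt; exact: subset_itv_oo_cc.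
have n0 (a : R) : {ae mu, forall t, t <> a}.
  exists [set a]; split => //; first exact: lebesgue_measure_set1.
  by move=> t /= /contrapT.
apply: filterS3 h (n0 0) (n0 1) => t Pt t0 t1; rewrite /= in_itv/= => t01.
by apply: Pt; rewrite in_itv/= !lt_neqAle; lra.
Qed.

(** Both sides integrate [w s] over 0 <= s <= t <= 1: for fixed s, the variable t runs through
    [[s, 1]], of length 1 - s. *)
Lemma tonelli_triangle (w : R -> R) : measurable_fun I01 w ->
  (forall s, I01 s -> 0 <= w s) ->
  (\int[mu]_(t in I01) \int[mu]_(s in `[0%R, t]) (w s)%:E =
   \int[mu]_(s in I01) (w s * (1 - s))%:E)%E.
Proof.
move=> mw w0.
(* The first coordinate is t, the second s. The bound 0 <= s is left to the restriction [W]. *)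
pose A : set (R * R) := [set p | p.2 <= p.1 <= 1].
pose W := w \_ I01.
have mW : measurable_fun setT W by apply/(measurable_restrictT _ _).1.
have W0 s : 0 <= W s.
  by rewrite /W patchE; case: ifPn => //; rewrite inE; exact: w0.
have mA : measurable A.
  have mb : measurable_fun setT (fun p : R * R => (p.2 <= p.1) && (p.1 <= 1)).
    by apply: measurable_and; apply: measurable_fun_ler.
  have := mb measurableT [set true] I; rewrite setTI.
  by congr measurable.
pose f (p : R * R) := (W p.2 * \1_A p)%:E.
have mf : measurable_fun setT f.
  apply/measurable_EFinP/measurable_funM; last exact: measurable_indic.
  exact: measurableT_comp.
have f0 p : (0 <= f p)%E by rewrite lee_fin mulr_ge0.
have fE t s : f (t, s) = (W s * (s <= t <= 1)%R%:R)%:E.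
  rewrite /f indicE/=; congr (_ * _%:R)%:E; congr nat_of_bool.
  by apply/idP/idP => [/set_mem//|/mem_set].
have inner_s t : (\int[mu]_s f (t, s))%E =
    ((fun t => \int[mu]_(s in `[0%R, t]) (w s)%:E)%E \_ I01) t.
  rewrite patchE; case: ifPn => [|]; rewrite ?inE ?notin_setE/= in_itv/=.
    move=> /andP[t0 t1]; rewrite [RHS]integral_mkcond; apply: eq_integral => s _.
    rewrite fE /W !patchE t1 andbT.
    case: ifPn => [|]; rewrite ?inE ?notin_setE/= in_itv/= => s01;
      case: ifPn => [|]; rewrite ?inE ?notin_setE/= in_itv/= => st.
    - by have [_ ->] := andP st; rewrite mulr1.
    - by move/negP: st; have [-> _] := andP s01 => /=/negPf ->; rewrite mulr0.
    - by exfalso; apply: s01; lra.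
    - by rewrite mul0r.
  move=> t01; apply: integral0_eq => s _; rewrite fE /W patchE.
  case: ifPn => [|_]; last by rewrite mul0r.
  rewrite inE/= in_itv/= => s01; case: (boolP (s <= t <= 1)) => [st|_].
    by exfalso; apply: t01; lra.
  by rewrite mulr0.
have inner_t s : (\int[mu]_t f (t, s))%E =
    ((fun s => (w s * (1 - s))%:E) \_ I01) s.
  transitivity ((W s)%:E * \int[mu]_t (\1_(`[s, 1]%classic) t)%:E)%E.
    rewrite -ge0_integralZl//; last by rewrite lee_fin.
    exact/measurable_EFinP/measurable_indic.
  rewrite integral_indic// setIT/= lebesgue_measure_itv/= /W !patchE.
  case: ifPn => [|_]; last by rewrite mul0e.
  (* The length formula distinguishes s < 1; in the remaining case s = 1 both values are 0. *)
  rewrite inE/= in_itv/= lte_fin => /andP[s0]; rewrite le_eqVlt.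
  by case: ltP => [//|_]; rewrite orbF => /eqP ->; rewrite subrr mulr0 mule0.
have := fubini_tonelli (m1 := mu) (m2 := mu) f mf f0.
under eq_integral do rewrite inner_s.
under [in X in _ = X -> _]eq_integral do rewrite inner_t.
by rewrite -!integral_mkcond.
Qed.

Lemma Rintegral_qfun (w : R -> R) : mu.-integrable I01 (EFin \o w) ->
  (forall s, I01 s -> 0 <= w s) ->
  \int[mu]_(t in I01) qfun w t = \int[mu]_(s in I01) (w s * (1 - s)).
Proof.
move=> intw w0.
have mw : measurable_fun I01 w.
  by apply/measurable_EFinP; exact: (measurable_int mu).
rewrite /Rintegral -tonelli_triangle//.
congr fine; apply: eq_integral => t; rewrite inE/= in_itv/= => t01.
rewrite fineK//; apply: integrable_fin_num => //.
apply: integrableS intw => //; apply: subset_itvl; rewrite bnd_simp.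
by case/andP: t01.
Qed.

Lemma continuous_gap (u v : R -> R) t : {for t, continuous u} ->
  {for t, continuous v} -> u t < v t -> \forall s \near t, u s < v s.
Proof.
move=> cu cv; rewrite -subr_gt0 => uv.
have cvu : {for t, continuous (fun s => v s - u s)} by apply: cvgB.
near=> s; rewrite -subr_gt0; near: s.
exact: (cvgr_gt (v t - u t) cvu).
Unshelve. all: by end_near. Qed.

(** * Conjugates of distortion functions *)

Section distortion.
Variable h : R -> R.
Hypothesis hh : distortion h.
Implicit Types t s : R.

Lemma conj_dist0 : conj_dist h 0 = 0.
Proof. by case: hh => _ [_ [_ [_ h1]]]; rewrite /conj_dist subr0 h1 subrr. Qed.

Lemma conj_dist1 : conj_dist h 1 = 1.
Proof. by case: hh => _ [_ [_ [h0 _]]]; rewrite /conj_dist subrr h0 subr0. Qed.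

Lemma conj_dist_itv t : 0 <= t <= 1 -> 0 <= conj_dist h t <= 1.
Proof.
move=> t01; case: hh => _ [_ [+ _]] => /(_ (1 - t)).
have -> : 0 <= 1 - t <= 1 by lra.
by move=> /(_ erefl); rewrite /conj_dist; lra.
Qed.

Lemma conj_dist_homo t s : 0 <= t -> t <= s -> s <= 1 ->
  conj_dist h t <= conj_dist h s.
Proof.
move=> t0 ts s1; case: hh => _ [hmono _]; rewrite /conj_dist lerD2l lerN2.
by apply: hmono; rewrite ?in_itv/=; lra.
Qed.

(** Restricted to interior points: at 0 and 1 a distortion has only one-sided difference quotients,
    and its values outside [[0, 1]] are arbitrary. *)
Lemma conj_dist_continuous t : t \in `]0, 1[ ->
  {for t, continuous (conj_dist h)}.
Proof.
rewrite in_itv/= => t01; case: hh => [[+ _] _] => /(_ (1 - t)).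
rewrite in_itv/= => dh.
have ch : {for 1 - t, continuous h}.
  by apply/differentiable_continuous/derivable1_diffP/dh; lra.
rewrite /conj_dist; apply: cvgB; first exact: cvg_cst.
apply: (@continuous_comp _ _ _ (fun t => 1 - t) h) => //.
by apply: cvgB; [exact: cvg_cst|exact: cvg_id].
Qed.

Lemma measurable_conj_dist : measurable_fun I01 (conj_dist h).
Proof.
apply: (@measurable_fun_itv_cc _ _ _ false true).
apply: open_continuous_measurable_fun; first exact: interval_open.
by move=> t; rewrite inE/= => /conj_dist_continuous.
Qed.

End distortion.

(** * The insurer's profit as the integral of a margin *)

Section insurer.
Variables Finv fd T : R -> R.
Hypothesis hfd_mes : measurable_fun I01 fd.
Hypothesis hfd_ge0 : forall t, 0 <= t <= 1 -> 0 <= fd t.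
Hypothesis hfd_int : mu.-integrable I01 (EFin \o fd).
Hypothesis hFinv : forall t, 0 <= t <= 1 ->
  Finv t = \int[mu]_(s in `[0, t]) fd s.
Hypothesis hFinv_incr : {in `[0, 1] &, {mono Finv : x y / x < y}}.
Hypothesis hT : distortion T.
Implicit Types qd g : R -> R.

Lemma QL_ae qd : QL fd qd -> {ae mu, forall t, I01 t -> 0 <= qd t <= fd t}.
Proof. by move=> [_ /ae_itv01]. Qed.

Lemma QL_integrable qd : QL fd qd -> mu.-integrable I01 (EFin \o qd).
Proof.
move=> qdQ; apply: (ae_le_integrable mu I01 _ qd fd) => //.
  by case: qdQ.
apply: filterS (QL_ae _ qdQ) => t + t01 => /(_ t01)/andP[q0 qf].
by rewrite ger0_norm.
Qed.

Lemma integrableB_QL qd : QL fd qd ->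
  mu.-integrable I01 (EFin \o (fun t => fd t - qd t)).
Proof.
move=> /QL_integrable intq.
by apply: eq_integrable (integrableB _ hfd_int intq).
Qed.

Lemma Rintegral_Finv_sub qd : QL fd qd ->
  \int[mu]_(t in I01) (Finv t - qfun qd t) =
  \int[mu]_(t in I01) ((fd t - qd t) * (1 - t)).
Proof.
(* The triangle identity wants nonnegativity everywhere, while [QL] grants it a.e.; the positive
   part [w] repairs this on a null set. *)
move=> qdQ; pose w t := Num.max (fd t - qd t) 0.
have mq : measurable_fun I01 qd by case: qdQ.
have mB : measurable_fun I01 (fun t => fd t - qd t) by exact: measurable_funB.
have mw : measurable_fun I01 w by exact: measurable_maxr.
have wE : {ae mu, forall t, I01 t -> fd t - qd t = w t}.
  apply: filterS (QL_ae _ qdQ) => t + t01 => /(_ t01)/andP[q0 qf].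
  by rewrite /w max_l// subr_ge0.
have intw : mu.-integrable I01 (EFin \o w).
  apply: (ae_le_integrable mu I01 _ w (fun t => fd t - qd t)) => //.
  - apply: filterS wE => t + t01 => /(_ t01) ->.
    by rewrite ger0_norm// /w le_max lexx orbT.
  - exact: integrableB_QL.
transitivity (\int[mu]_(t in I01) qfun w t).
  apply: eq_Rintegral => t; rewrite inE/= in_itv/= => t01.
  have sub : `[0, t] `<=` I01.
    by apply: subset_itvl; rewrite bnd_simp; case/andP: t01.
  rewrite hFinv// -RintegralB//; first last.
  - by apply: integrableS (QL_integrable _ qdQ).
  - by apply: integrableS hfd_int.
  apply: ae_eq_Rintegral => //.
  - exact: measurable_funS mB.
  - exact: measurable_funS mw.
  - by apply: filterS wE => s + s0t; apply; exact: sub.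
rewrite Rintegral_qfun//; last by move=> s _; rewrite /w le_max lexx orbT.
apply: ae_eq_Rintegral => //.
- by apply: measurable_funM => //; exact: measurable_funB.
- by apply: measurable_funM => //; exact: measurable_funB.
- by apply: filterS wE => s + s0t => /(_ s0t) ->.
Qed.

Lemma integrable_margin qd g : distortion g -> QL fd qd ->
  mu.-integrable I01 (EFin \o (fun t => (fd t - qd t) * (t - conj_dist g t))).
Proof.
move=> hg qdQ; apply: (integrable_mulr_bounded mu I01 _ _ _ 1) => //.
- by apply: measurable_funB => //; exact: measurable_conj_dist.
- move=> t; rewrite /= in_itv/= => t01; have := conj_dist_itv _ hg _ t01.
  by rewrite ler_norml; lra.
- exact: integrableB_QL.
Qed.

(** The ceded slope [fd - qd] has weight g(1 - t) = 1 - G in the premium and 1 - t in the expected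
    claim; the difference of the weights is t - G. *)
Lemma VInE qd g : distortion g -> QL fd qd ->
  VIn Finv fd qd g = \int[mu]_(t in I01) ((fd t - qd t) * (t - conj_dist g t)).
Proof.
move=> hg qdQ; rewrite /VIn Rintegral_Finv_sub// -RintegralB//.
- by apply: eq_Rintegral => t _; rewrite /conj_dist; ring.
- apply: eq_integrable (integrable_mulr_bounded mu I01 _ (fun t => fd t - qd t)
    (fun t => 1 - conj_dist g t) 1 _ _ _) => //.
  + by move=> t _; rewrite /= /conj_dist opprB addrCA subrr addr0.
  + by apply: measurable_funB => //; exact: measurable_conj_dist.
  + move=> t; rewrite /= in_itv/= => t01; have := conj_dist_itv _ hg _ t01.
    by rewrite ler_norml; lra.
  + exact: integrableB_QL.
- apply: (integrable_mulr_bounded mu I01 _ _ _ 1) => //.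
  + exact: measurable_funB.
  + by move=> t; rewrite /= in_itv/= => t01; rewrite ler_norml; lra.
  + exact: integrableB_QL.
Qed.

(** * The policyholder's best response *)

Lemma integrable_QL_mul qd g : distortion g -> QL fd qd ->
  mu.-integrable I01
    (EFin \o (fun t => qd t * (conj_dist g t - conj_dist T t))).
Proof.
move=> hg qdQ; apply: (integrable_mulr_bounded mu I01 _ _ _ 1) => //.
- by apply: measurable_funB; exact: measurable_conj_dist.
- move=> t; rewrite /= in_itv/= => t01.
  have := conj_dist_itv _ hg _ t01; have := conj_dist_itv _ hT _ t01.
  by rewrite ler_norml; lra.
- exact: QL_integrable.
Qed.

(** The second term of [rhoPol] is common to both contracts and cancels. *)
Lemma rhoPol_le qd qd' g :
  (rhoPol T fd qd g <= rhoPol T fd qd' g) =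
  (\int[mu]_(t in I01) (qd t * (conj_dist g t - conj_dist T t)) <=
   \int[mu]_(t in I01) (qd' t * (conj_dist g t - conj_dist T t))).
Proof.
rewrite /rhoPol lerD2r; congr (_ <= _);
  by apply: eq_Rintegral => t _; rewrite /conj_dist; ring.
Qed.

(* The comparison contract [q0] retains everything where coverage is dear,
   nothing where it is cheap, and coincides with [qd] in case of indifference. *)
Lemma ph_optimalP qd g : distortion g -> QL fd qd ->
  ph_optimal T fd qd g <->
  {ae mu, forall t, I01 t ->
    (conj_dist g t < conj_dist T t -> qd t = fd t) /\
    (conj_dist T t < conj_dist g t -> qd t = 0)}.
Proof.
move=> hg qdQ; have mG := measurable_conj_dist _ hg.
have mT := measurable_conj_dist _ hT.
have mq : measurable_fun I01 qd by case: qdQ.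
split=> [[_ opt]|qdopt]; last first.
  split=> // qd' qdQ'; rewrite rhoPol_le; apply: ae_le_Rintegral => //.
  - exact: integrable_QL_mul.
  - exact: integrable_QL_mul.
  apply: filterS2 qdopt (QL_ae _ qdQ') => t + + t01 => /(_ t01)[ql qr] /(_ t01).
  have [lt|lt|->] := ltgtP (conj_dist g t) (conj_dist T t).
  - by rewrite (ql lt) => q'; nra.
  - by rewrite (qr lt) => q'; nra.
  - by rewrite subrr !mulr0.
pose q0 t := if conj_dist g t < conj_dist T t then fd t
             else if conj_dist T t < conj_dist g t then 0 else qd t.
have q0Q : QL fd q0.
  split.
    by do 2 apply: measurable_fun_if_lt => //.
  apply/ae_itv01; apply: filterS (QL_ae _ qdQ) => t + t01 => /(_ t01) q01.
  have := hfd_ge0 t; rewrite /= in_itv/= in t01; move=> /(_ t01) f0.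
  by rewrite /q0; case: ifPn => // _; [lra|case: ifPn => // _; lra].
(* [q0] costs at most as much as [qd] pointwise, so optimality of [qd] forces equal integrands a.e.;
   where G and S differ, the factor G - S cancels. *)
have := opt _ q0Q; rewrite rhoPol_le => le.
have : {ae mu, forall t, I01 t -> q0 t * (conj_dist g t - conj_dist T t) =
    qd t * (conj_dist g t - conj_dist T t)}.
  apply: ae_eq_le_Rintegral le => //.
  - exact: integrable_QL_mul.
  - exact: integrable_QL_mul.
  apply: filterS (QL_ae _ qdQ) => t + t01 => /(_ t01) q01; rewrite /q0.
  by case: ltgtP => gT; [nra|nra|rewrite gT subrr !mulr0].
apply: filterS => t + t01 => /(_ t01); rewrite /q0.
case: ltgtP => // gT /mulIf; rewrite subr_eq0 ?(lt_eqF gT) ?(gt_eqF gT).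
- by move=> /(_ isT) ->.
- by move=> /(_ isT) ->.
Qed.

(** * The upper bound on the profit, its attainment and its equality case *)

Definition max_margin t :=
  fd t * (t - conj_dist T t) * \1_[set z | conj_dist T z < z] t.

Lemma max_marginE t : max_margin t =
  if conj_dist T t < t then fd t * (t - conj_dist T t) else 0.
Proof.
rewrite /max_margin indicE; case: ifPn => h.
  by rewrite mem_set// mulr1.
by rewrite memNset ?mulr0//; exact/negP.
Qed.

Lemma integrable_max_margin : mu.-integrable I01 (EFin \o max_margin).
Proof.
have mT := measurable_conj_dist _ hT.
have mtT : measurable_fun I01 (fun t => t - conj_dist T t).
  exact: measurable_funB.
apply: (ae_le_integrable mu I01 _ max_margin fd) => //.
  rewrite (_ : max_margin = fun t =>
    if conj_dist T t < t then fd t * (t - conj_dist T t) else 0).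
    by apply: measurable_fun_if_lt => //; exact: measurable_funM.
  by apply/funext => t; exact: max_marginE.
apply: aeW => t; rewrite /= in_itv/= => t01; rewrite max_marginE ler_norml.
have := hfd_ge0 _ t01; have := conj_dist_itv _ hT _ t01.
by case: ifPn => ?; nra.
Qed.

(** If G < S nothing is ceded and the margin is 0; if S < G all of [fd] is ceded at t - G < t - S;
    if G = S a part of [fd] is ceded at t - S. *)
Lemma margin_le_max qd g : distortion g -> ph_optimal T fd qd g ->
  {ae mu, forall t, I01 t ->
    (fd t - qd t) * (t - conj_dist g t) <= max_margin t}.
Proof.
move=> hg qdo; have qdQ : QL fd qd by case: qdo.
have /(ph_optimalP _ _ hg qdQ) qdae := qdo.
apply: filterS2 qdae (QL_ae _ qdQ) => t + + t01.
move=> /(_ t01)[ql qr] /(_ t01) q01; rewrite max_marginE.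
have [lt|lt|gT] := ltgtP (conj_dist g t) (conj_dist T t).
- rewrite (ql lt); rewrite (ql lt) in q01.
  by case: ifPn => ?; nra.
- rewrite (qr lt) in q01 *.
  by case: ltP => ?; nra.
- by rewrite gT; case: ltP => ?; nra.
Qed.

Lemma VIn_le_max qd g : distortion g -> ph_optimal T fd qd g ->
  VIn Finv fd qd g <= \int[mu]_(t in I01) max_margin t.
Proof.
move=> hg qdo; have qdQ : QL fd qd by case: qdo.
rewrite VInE//; apply: ae_le_Rintegral => //.
- exact: integrable_margin.
- exact: integrable_max_margin.
- exact: margin_le_max.
Qed.

(** At g = T the policyholder is indifferent everywhere, so the insurer may select the contract that
    cedes exactly where S t < t. *)
Lemma VIn_max_attained : exists2 qd, ph_optimal T fd qd T &
  VIn Finv fd qd T = \int[mu]_(t in I01) max_margin t.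
Proof.
pose q t := if conj_dist T t < t then 0 else fd t.
have qQ : QL fd q.
  split.
    by apply: measurable_fun_if_lt => //; exact: measurable_conj_dist.
  apply/ae_itv01/aeW => t /=; rewrite in_itv/= => /hfd_ge0 f0.
  by rewrite /q; case: ifPn => _; rewrite ?lexx f0.
exists q; first by apply/ph_optimalP => //; apply: aeW => t _; rewrite ltxx.
rewrite VInE//; apply: eq_Rintegral => t _; rewrite max_marginE /q.
by case: ifPn => _; rewrite ?subr0// subrr mul0r.
Qed.

Lemma insurer_optimalE qd g : insurer_optimal T Finv fd qd g <->
  [/\ distortion g, ph_optimal T fd qd g &
      VIn Finv fd qd g = \int[mu]_(t in I01) max_margin t].
Proof.
split=> [[hg [qdo opt]]|[hg qdo VE]].
  split=> //; apply/le_anti; rewrite VIn_le_max//=.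
  by have [q qo <-] := VIn_max_attained; exact: opt.
by split=> //; split=> // g' qd' hg' qdo'; rewrite VE VIn_le_max.
Qed.

Lemma VIn_maxP qd g : distortion g -> ph_optimal T fd qd g ->
  VIn Finv fd qd g = \int[mu]_(t in I01) max_margin t <->
  {ae mu, forall t, I01 t ->
    (fd t - qd t) * (t - conj_dist g t) = max_margin t}.
Proof.
move=> hg qdo; have qdQ : QL fd qd by case: qdo.
rewrite VInE//; split=> [VE|eq].
  apply: ae_eq_le_Rintegral; rewrite ?VE//.
  - exact: integrable_margin.
  - exact: integrable_max_margin.
  - exact: margin_le_max.
apply: ae_eq_Rintegral => //.
- apply/measurable_EFinP; apply: (measurable_int mu).
  exact: integrable_margin.
- apply/measurable_EFinP; apply: (measurable_int mu).
  exact: integrable_max_margin.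
Qed.

(** * From almost everywhere identities to pointwise price conditions *)

Lemma fd_not_ae0 (a b : R) : 0 <= a -> a < b -> b <= 1 ->
  ~ {ae mu, forall t, t \in `]a, b] -> fd t = 0}.
Proof.
move=> a0 ab b1 f0.
(* This strictly positive increment is the integral of [fd] over []a, b]], which would be 0. *)
have : Finv a < Finv b by rewrite hFinv_incr ?in_itv/=; lra.
rewrite -subr_gt0 !hFinv; [|lra|lra].
have sub0b : `[0, b] `<=` I01 by apply: subset_itvl; rewrite bnd_simp.
have subab : `]a, b] `<=` I01.
  by apply: subset_itv; rewrite bnd_simp.
rewrite Rintegral_itvB ?bnd_simp//; last 2 first.
- by apply: integrableS hfd_int.
- exact: ltW.
rewrite (_ : Rintegral _ _ _ = \int[mu]_(t in `]a, b]) 0).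
  by rewrite Rintegral_cst// mul0r ltxx.
apply: ae_eq_Rintegral => //; first exact: measurable_funS hfd_mes.
Qed.

(** Contradiction device: a strict inequality between continuous functions holds around t, so it
    cannot force [fd] to vanish a.e. where it holds. *)
Lemma fd_not_near0 (P : R -> Prop) (t : R) :
  t \in `]0, 1[ -> (\forall s \near t, P s) ->
  ~ {ae mu, forall s, I01 s -> P s -> fd s = 0}.
Proof.
move=> t01 Pt f0.
have : \forall s \near t, P s /\ s \in `]0, 1[.
  by apply: filterI => //; exact: near_in_itvoo.
move=> /nbhs_ballP[e /= e0 Pe].
have {}Pe s : `|t - s| < e -> P s /\ 0 < s < 1.
  by move=> /Pe[]; rewrite in_itv.
have [|_ ha] := Pe (t - e / 2); first by rewrite ltr_norml; lra.
have [|_ hb] := Pe (t + e / 2); first by rewrite ltr_norml; lra.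
apply: (@fd_not_ae0 (t - e / 2) (t + e / 2)); [lra|lra|lra|].
apply: filterS f0 => s f0; rewrite in_itv/= => /andP[sa sb].
have [|Ps s01] := Pe s; first by rewrite ltr_norml; lra.
by apply: f0 => //=; rewrite in_itv/=; lra.
Qed.

Section necessity.
Variables qds gs : R -> R.
Hypothesis hgs : distortion gs.
Local Notation G := (conj_dist gs).
Local Notation TT := (conj_dist T).
Hypothesis qds_resp : {ae mu, forall t, I01 t ->
  (G t < TT t -> qds t = fd t) /\ (TT t < G t -> qds t = 0)}.
Hypothesis qds_max : {ae mu, forall t, I01 t ->
  (fd t - qds t) * (t - G t) = max_margin t}.

(** A gap between [G] and [TT] would persist near t. If [TT] < [G], all is ceded at a margin below
    the maximal one; if [G] < [TT], nothing is ceded although the maximal margin is positive. Either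
    way [fd] would vanish a.e. nearby. *)
Lemma optimal_price_insured t : 0 <= t <= 1 -> TT t < t -> G t = TT t.
Proof.
move=> t01 Tt.
(* Conjugates fix 0 and 1, so a strict inequality places t in the interior, where continuity is
   available. *)
have t0 : t != 0 by apply: contraTneq Tt => ->; rewrite conj_dist0 ?ltxx.
have t1 : t != 1 by apply: contraTneq Tt => ->; rewrite conj_dist1 ?ltxx.
have t01' : t \in `]0, 1[ by rewrite in_itv/= !lt_neqAle t1 eq_sym t0.
have cG := conj_dist_continuous _ hgs _ t01'.
have cT := conj_dist_continuous _ hT _ t01'.
have nTt := continuous_gap _ (fun s => s) _ cT cvg_id Tt.
apply/eqP; rewrite eq_le !leNgt; apply/andP; split; apply/negP => gap.
- have ngap := continuous_gap _ _ _ cT cG gap.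
  apply: (fd_not_near0 _ t t01' (filterI nTt ngap)).
  apply: filterS2 qds_resp qds_max => s + + s01 [Ts gaps].
  move=> /(_ s01)[_ /(_ gaps) qs] /(_ s01); rewrite max_marginE Ts qs subr0.
  by move=> h; nra.
- have ngap := continuous_gap _ _ _ cG cT gap.
  apply: (fd_not_near0 _ t t01' (filterI nTt ngap)).
  apply: filterS2 qds_resp qds_max => s + + s01 [Ts gaps].
  move=> /(_ s01)[/(_ gaps) qs _] /(_ s01); rewrite max_marginE Ts qs subrr.
  by move=> h; nra.
Qed.

(** Otherwise everything would be ceded near t at the negative margin s - [G s], while [max_margin]
    is nonnegative, so [fd] would vanish there. *)
Lemma optimal_price_retained t : 0 <= t <= 1 -> t <= TT t -> G t <= TT t.
Proof.
move=> t01 tT; rewrite leNgt; apply/negP => gap.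
have t0 : t != 0 by apply: contraTneq gap => ->; rewrite !conj_dist0 ?ltxx.
have t1 : t != 1 by apply: contraTneq gap => ->; rewrite !conj_dist1 ?ltxx.
have t01' : t \in `]0, 1[ by rewrite in_itv/= !lt_neqAle t1 eq_sym t0.
have cG := conj_dist_continuous _ hgs _ t01'.
have cT := conj_dist_continuous _ hT _ t01'.
(* The hypothesis t <= [TT t] may be an equality and fail nearby; the strict t < [G t] survives. *)
have nTt := continuous_gap (fun s => s) _ _ cvg_id cG (le_lt_trans tT gap).
have ngap := continuous_gap _ _ _ cT cG gap.
apply: (fd_not_near0 _ t t01' (filterI nTt ngap)).
apply: filterS2 qds_resp qds_max => s + + s01 [Ts gaps].
move=> /(_ s01)[_ /(_ gaps) qs] /(_ s01); rewrite max_marginE qs subr0.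
rewrite /= in_itv/= in s01; have := hfd_ge0 s s01.
by case: ltP => ? ? ?; nra.
Qed.

End necessity.

End insurer.

End unit_interval.

(** * Characterisation of the optimal pairs and the profit formula *)

Theorem theorem2 (R : realType) (Finv fd T gs qds : R -> R)
  (* (F_X^{-1})' = fd : nonnegative, integrable on [0,1] *)
  (hfd_mes : measurable_fun (`[0, 1] : set R) fd)
  (hfd_ge0 : forall t, 0 <= t <= 1 -> 0 <= fd t)
  (hfd_int : (@lebesgue_measure R).-integrable `[0, 1] (fun t => (fd t)%:E))
  (* F_X^{-1}(t) = int_0^t (F_X^{-1})', so F_X^{-1}(0) = 0, range [0, M] *)
  (hFinv : forall t, 0 <= t <= 1 ->
     Finv t = \int[@lebesgue_measure R]_(s in `[0, t]) fd s)
  (* X continuous with strictly increasing F_X: quantile strictly increasing *)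
  (hFinv_incr : {in `[0, 1] &, {mono Finv : x y / x < y}})
  (* policyholder's distortion *)
  (hT : distortion T) :
  (* g* a distortion function, q*_{g*} in Q_L given by its derivative qds *)
  distortion gs -> QL fd qds ->
  (insurer_optimal T Finv fd qds gs <->
   ( (* (1) *)
     (forall t, 0 <= t <= 1 -> gs t = 1 - conj_dist gs (1 - t)) /\
     (forall t, 0 <= t <= 1 ->
        (conj_dist T t < t -> conj_dist gs t = conj_dist T t) /\
        (t <= conj_dist T t ->
           sup [set conj_dist gs z | z in `[0, t[] <= conj_dist gs t
           /\ conj_dist gs t <= conj_dist T t)) /\
     (* (2) *)
     {ae @lebesgue_measure R, forall t, t \in `]0, 1[ ->
        (conj_dist T t < t -> qds t = 0) /\
        (conj_dist gs t = conj_dist T t /\ conj_dist T t = t ->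
           0 <= qds t <= fd t) /\
        ((conj_dist gs t < conj_dist T t /\ conj_dist T t = t)
          \/ conj_dist T t > t -> qds t = fd t)})) /\
  (* expected profit *)
  (insurer_optimal T Finv fd qds gs ->
   VIn Finv fd qds gs =
   \int[@lebesgue_measure R]_(t in `[0, 1])
      (fd t * (t - conj_dist T t) * \1_[set z | conj_dist T z < z] t)).
Proof.
move=> hgs qdsQ.
have opE := insurer_optimalE Finv fd T hfd_mes hfd_ge0 hfd_int hFinv hT qds gs.
split; last by move=> /opE[].
have phP := ph_optimalP fd T hfd_mes hfd_ge0 hfd_int hT qds gs hgs qdsQ.
have maxP := VIn_maxP Finv fd T hfd_mes hfd_ge0 hfd_int hFinv hT qds gs hgs.
have QLae := QL_ae fd qds qdsQ.
split=> [/opE[_ qdo VE]|[_ [price /ae_itv01 alloc]]].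
  have /phP resp := qdo; have /(maxP qdo) mx := VE.
  have insured := optimal_price_insured Finv fd T hfd_mes hfd_int hFinv
    hFinv_incr hT qds gs hgs resp mx.
  have retained := optimal_price_retained Finv fd T hfd_mes hfd_ge0 hfd_int hFinv
    hFinv_incr hT qds gs hgs resp mx.
  split=> [t _|].
    by rewrite /conj_dist !subKr.
  split=> [t t01|].
    split; first exact: insured.
    move=> tT; split; last exact: retained.
    (* At t = 0 the set is empty and its [sup] is 0 by convention, which is also the value of the
       conjugate. *)
    have [->|t0] := eqVneq t 0.
      by rewrite set_itv_ge ?bnd_simp// image_set0 sup0 conj_dist0.
    apply: ge_sup.
      exists (conj_dist gs 0); exists 0 => //=.
      by rewrite in_itv/= lexx lt_neqAle eq_sym t0; lra.
    move=> _ [z /= + <-]; rewrite in_itv/= => z0t.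
    by apply: conj_dist_homo => //; lra.
  apply/ae_itv01; apply: filterS3 resp mx QLae => t + + + t01.
  move=> /(_ t01)[rl rr] /(_ t01); rewrite max_marginE => mt /(_ t01) q01.
  rewrite /= in_itv/= in t01.
  split=> [Tt|]; last split=> // -[[/rl//]|tT].
    by move: mt; rewrite Tt insured// => mt; nra.
  (* When G = S > t the policyholder is indifferent; the zero maximal margin then forbids ceding at
     the negative margin t - S. *)
  have := retained t t01 (ltW tT); rewrite le_eqVlt => /predU1P[gT|/rl//].
  by move: mt; rewrite ltNge (ltW tT)/= gT => mt; nra.
(* Condition (1) excludes S < G, and G < S can occur only where t <= S; there condition (2)
   prescribes [fd]. *)
have resp : {ae @lebesgue_measure R, forall t, `[0, 1]%classic t ->
    (conj_dist gs t < conj_dist T t -> qds t = fd t) /\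
    (conj_dist T t < conj_dist gs t -> qds t = 0)}.
  apply: filterS alloc => t + t01 => /(_ t01)[a1 [a2 a3]].
  rewrite /= in_itv/= in t01; have [p1 p2] := price t t01.
  have [Tt|Tt|Tt] := ltgtP (conj_dist T t) t.
  - by rewrite (p1 Tt) ltxx.
  - have [_ gT] := p2 (ltW Tt).
    by split=> gt; [apply: a3; right|exfalso; lra].
  - have [|_ gT] := p2; first by rewrite Tt.
    by split=> gt; [apply: a3; left|exfalso; lra].
have qdo : ph_optimal T fd qds gs by exact/phP.
apply/opE; split=> //; apply/(maxP qdo).
apply: filterS2 alloc resp => t + + t01 => /(_ t01)[a1 [a2 a3]] /(_ t01)[r _].
rewrite max_marginE; rewrite /= in_itv/= in t01; have [p1 p2] := price t t01.
have [Tt|Tt|Tt] := ltgtP (conj_dist T t) t.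
- by rewrite (p1 Tt) (a1 Tt) subr0.
- by rewrite a3 ?subrr ?mul0r//; right.
(* Where S t = t, the slope is free only if G = S, and then the margin t - G is 0; if G < S nothing
   is ceded. *)
- have [|_] := p2; first by rewrite Tt.
  rewrite le_eqVlt => /predU1P[->|/r ->].
    by rewrite Tt subrr mulr0.
  by rewrite subrr mul0r.
Qed.
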